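(* For every constant $\epsilon\in(0,1)$ there exists a (possibly randomized) algorithm for the submodular random order streaming problem with a matroid constraint which, on every instance with $n$ items, a matroid of rank $k$, and a monotone submodular function $f$, achieves a $$\frac{1}{2}\left(1-\frac{1}{e^2}-\epsilon-O\!\left(\frac1k\right)\right)$$ approximation to $\mathrm{OPT}$ while using a memory buffer of size at most $\eta_\epsilon(k)=O(k)$. Moreover, the number of objective function evaluations for each item, amortized over the $n$ items, is $O\!\left(k+\frac{k^2}{n}\right)$.
   Context: Submodular random order streaming problem with a matroid constraint. An instance consists of a set $\mathcal{U}$ of $n$ items, a matroid $\mathcal{M}=(\mathcal{U},\mathcal{I})$ of rank $k$, and a monotone submodular function $f:2^{\mathcal{U}}\to\mathbb{R}_{\ge0}$. The items arrive one at a time in a single pass in uniformly random order; $n$ and $k$ are known, but the set $\mathcal{U}$ is not. The algorithm may keep previously seen items in a memory buffer; items in the buffer may be discarded and replaced by newly arriving ones, but an item not in the buffer is lost. A memory buffer of size $\eta(k)$ means that at most $\eta(k)$ items are stored at any time. The algorithm has value oracle access to $f$ and independence oracle access to $\mathcal{M}$ (on sets of items available to it). At the end it outputs a set $S\in\mathcal{I}$ of items from the buffer. It achieves a $c$ approximation if $\mathbb{E}[f(S)]\ge c\cdot\mathrm{OPT}$, where $\mathrm{OPT}=\max_{S\subseteq\mathcal{U},\,S\in\mathcal{I}}f(S)$ and the expectation is over the arrival order and internal randomness. ''Amortized over the $n$ items'' means the total number of evaluations of $f$ divided by $n$. $O(\cdot)$ is asymptotic in $n$ and $k$, with $\epsilon$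 regarded as a constant (hidden constants may depend on $\epsilon$). *)

(* Defs.v *)
From mathcomp Require Import all_boot all_order all_algebra.
From mathcomp Require Import reals.

Set Implicit Arguments.
Unset Strict Implicit.
Unset Printing Implicit Defensive.

Import Order.TTheory GRing.Theory Num.Theory.
Local Open Scope ring_scope.

Record matroid (U : finType) := Matroid {
  indep : {set U} -> bool;
  indep_set0 : indep set0;
  indep_subset : forall A B : {set U}, A \subset B -> indep B -> indep A;
  indep_augment : forall A B : {set U}, indep A -> indep B -> (#|A| < #|B|)%N ->
    exists2 x, x \in B :\: A & indep (x |: A) }.

Definition rank (U : finType) (M : matroid U) : nat :=
  (\max_(A : {set U} | indep M A) #|A|)%N.

Definition monotone_setfun (R : realType) (U : finType) (f : {set U} -> R) :=
  forall A B : {set U}, A \subset B -> f A <= f B.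

Definition submodular (R : realType) (U : finType) (f : {set U} -> R) :=
  forall A B : {set U}, f (A :|: B) + f (A :&: B) <= f A + f B.

(* The default value 0 plays no role for nonnegative f, since the empty set is
   independent. *)
Definition OPT (R : realType) (U : finType) (M : matroid U)
    (f : {set U} -> R) : R :=
  \big[Num.max/0]_(S : {set U} | indep M S) f S.

(* A randomized streaming algorithm for a stream of n items, as an interactive
   decision tree. It never sees the ground set: it names an item by its arrival
   time, an element of 'I_n, and learns about items only through the oracle
   answers passed to its continuations. Its working memory for anything other
   than items is unrestricted.
     Value A c  queries f on the items that arrived at the times in A;
     Indep A c  asks whether these items form an independent set;
     Draw N c   draws an element of 'I_N.+1 uniformly at random;
     Next D c   keeps in the buffer only the items with arrival time in D, and
                receives the next item of the stream, which enters the buffer;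
     Output A   stops and returns the items with arrival time in A. *)
Inductive streaming_alg (R : Type) (n : nat) : Type :=
  | Value of {set 'I_n} & (R -> streaming_alg R n)
  | Indep of {set 'I_n} & (bool -> streaming_alg R n)
  | Draw (N : nat) of ('I_N.+1 -> streaming_alg R n)
  | Next of {set 'I_n} & streaming_alg R n
  | Output of {set 'I_n}.

Section Execution.
Variables (R : realType) (n : nat) (U : finType).
Variables (M : matroid U) (f : {set U} -> R).
(* o i is the item arriving at time i. *)
Variable o : {ffun 'I_n -> U}.

(* Every execution on the arrival order o, from the configuration in which t
   items have arrived and the buffer is B, holds at most m items at any time
   (a newly arrived item included), only refers to items in the buffer, reads
   the whole stream, and returns an independent set. *)
Fixpoint valid_run (m t : nat) (B : {set 'I_n}) (p : streaming_alg R n)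
    : bool :=
  match p with
  | Value A c => (A \subset B) && valid_run m t B (c (f (o @: A)))
  | Indep A c => (A \subset B) && valid_run m t B (c (indep M (o @: A)))
  | Draw N c => [forall i : 'I_N.+1, valid_run m t B (c i)]
  | Next D c =>
      if insub t is Some i
      then [&& D \subset B, (#|i |: D| <= m)%N & valid_run m t.+1 (i |: D) c]
      else false
  | Output A => [&& t == n, A \subset B & indep M (o @: A)]
  end.

(* Worst case over the internal randomness; repeated queries are counted. *)
Fixpoint num_evals (p : streaming_alg R n) : nat :=
  match p with
  | Value A c => (num_evals (c (f (o @: A)))).+1
  | Indep A c => num_evals (c (indep M (o @: A)))
  | Draw N c => (\max_(i < N.+1) num_evals (c i))%N
  | Next D c => num_evals c
  | Output _ => 0%N
  end.

(* Expectation of the value of the returned set over the internal randomness. *)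
Fixpoint mean_value (p : streaming_alg R n) : R :=
  match p with
  | Value A c => mean_value (c (f (o @: A)))
  | Indep A c => mean_value (c (indep M (o @: A)))
  | Draw N c => (\sum_(i < N.+1) mean_value (c i)) / N.+1%:R
  | Next D c => mean_value c
  | Output A => f (o @: A)
  end.

End Execution.

(* When #|U| = n, the injective o are exactly the n! arrival orders of U. *)
Definition random_order_value (R : realType) (n : nat) (U : finType)
    (M : matroid U) (f : {set U} -> R) (p : streaming_alg R n) : R :=
  (\sum_(o : {ffun 'I_n -> U} | injectiveb o) mean_value M f o p) / n`!%:R.

(* Main.v *)
(* Cut the stream into W = m^2 k windows by giving every item an independent
   uniform label; only the numbers of equal labels are needed to find the window
   boundaries online, and the stream then is a uniformly random order of the
   items sorted by label. In each window the best single exchange on the current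
   independent set S is carried out, the candidates being the arriving items and
   one random item of the list H of all items ever selected; |H| <= W = O(k).

   An item e outside H has left no trace: moving its label to any window from j
   on does not change (H, S) before window j. Hence, given (H, S), every item of
   an optimal set O is a candidate in window j with probability at least 1/W;
   given in addition that it is one, any other item is a candidate as well with
   probability at most 1/(W - j). So the expected gain of window j is at least
   (1/W) (1 - k/(W - j)) times the sum over O of the exchange gains, which is at
   least f(O) - 2 f(S). Solving this recurrence up to W - j = m k gives
   (1/2) (1 - exp(-2 (1 - 1/m)^2)) OPT, and m of order 1/eps suffices. *)

Require Import Defs.
From mathcomp Require Import all_boot all_order all_algebra.
From mathcomp Require Import reals sequences.
From mathcomp Require Import boolp exp zify ring lra.
Import Order.TTheory GRing.Theory Num.Theory.
Local Open Scope ring_scope.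

Set Implicit Arguments.
Unset Strict Implicit.

(** * Matroids and submodular functions *)

Section Matroids.
Variables (U : finType) (M : matroid U).

Lemma indep_card (A : {set U}) : indep M A -> (#|A| <= rank M)%N.
Proof. exact: leq_bigmax_cond. Qed.

Lemma indep_extend (A S : {set U}) : indep M A -> indep M S ->
  exists B : {set U}, [/\ indep M B, A \subset B, B \subset A :|: S
    & (#|S| <= #|B|)%N].
Proof.
move=> iA iS.
pose P (B : {set U}) := [&& indep M B, A \subset B & B \subset A :|: S].
have PA : P A by rewrite /P iA subxx subsetUl.
have [B /and3P[iB AB BAS] Bmax] := arg_maxnP (fun B : {set U} => #|B|) PA.
exists B; split=> //; rewrite leqNgt; apply/negP => ltBS.
have [x /setDP[xS xB] ixB] := indep_augment iB iS ltBS.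
have /Bmax : P (x |: B).
  by rewrite /P ixB subsetU ?AB ?orbT //= subUset BAS sub1set inE xS orbT.
by rewrite /= cardsU1 xB add1n ltnn.
Qed.

End Matroids.

(** * Comparison of two sums through level sets *)

Section LayerCake.
Variables (R : realDomainType) (U : finType).

(** Greedy pairing: an item [e] with the largest positive [u] is matched with some [d] of weight at
    least [u e], and both are removed. Items with nonpositive [u] need no partner. *)
Lemma sum_le_level_sets (u w : U -> R) (E D : {set U}) :
  (forall d, d \in D -> 0 <= w d) ->
  (forall tau : R, 0 < tau ->
     (#|[set e in E | (tau <= u e)%R]| <= #|[set d in D | (tau <= w d)%R]|)%N) ->
  \sum_(e in E) u e <= \sum_(d in D) w d.
Proof.
elim: {E}#|E| {-2}E (leqnn #|E|) D => [|m IH] E cE D w0 EleD.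
  rewrite leqn0 cards_eq0 in cE; rewrite (eqP cE) big_set0.
  exact: sumr_ge0.
have [/exists_inP[e0 e0E u0]|] := boolP [exists e in E, 0 < u e]; last first.
  rewrite negb_exists_in => /forall_inP u0.
  apply: (@le_trans _ _ 0); last exact: sumr_ge0.
  by apply: sumr_le0 => e /u0; rewrite -leNgt.
case: (arg_maxP u e0E) => e eE' emax.
have {eE'} eE : e \in E := eE'.
have ue : 0 < u e by apply: lt_le_trans (emax _ e0E).
have : (0 < #|[set d in D | (u e <= w d)%R]|)%N.
  apply: leq_trans (EleD _ ue); rewrite card_gt0; apply/set0Pn.
  by exists e; rewrite inE eE lexx.
rewrite card_gt0 => /set0Pn[d]; rewrite inE => /andP[dD uw].
rewrite (big_setD1 _ eE) (big_setD1 _ dD) /=; apply: lerD => //.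
apply: IH.
- by move: cE; rewrite (cardsD1 e) eE.
- by move=> x /setD1P[_ /w0].
(* Above [u e] the level set of [E] is empty; up to [u e] both level sets lose exactly one item. *)
move=> tau tau0; have [tu|ut] := leP tau (u e); last first.
  rewrite (_ : [set _ in _ | _] = set0) ?cards0 //.
  apply/setP => x; rewrite !inE; apply/negP => /andP[/andP[_ xE] tx].
  by have := le_trans tx (emax _ xE : u x <= u e); rewrite leNgt ut.
have := EleD _ tau0.
rewrite (cardsD1 e) (cardsD1 d [set _ in D | _]) !inE eE dD tu (le_trans tu uw).
rewrite !add1n ltnS.
rewrite (_ : _ :\ e = [set x in E :\ e | tau <= u x]); last first.
  by apply/setP => x; rewrite !inE andbA.
rewrite (_ : _ :\ d = [set x in D :\ d | tau <= w x]) //.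
by apply/setP => x; rewrite !inE andbA.
Qed.

End LayerCake.

Section Submodular.
Variables (R : realType) (U : finType) (f : {set U} -> R).
Hypotheses (mono : monotone_setfun f) (sub : submodular f).

Lemma marginal_le (x : U) (A B : {set U}) : A \subset B ->
  f (x |: B) - f B <= f (x |: A) - f A.
Proof.
move=> AB; have := sub (x |: A) B.
have -> : (x |: A) :|: B = x |: B by rewrite -setUA (setUidPr AB).
have /mono : A \subset (x |: A) :&: B by rewrite subsetI AB subsetUr.
by move=> h1 h2; rewrite lerBlDr addrAC lerBrDr (le_trans _ h2) // lerD2l.
Qed.

Lemma sum_marginal_ge (S O : {set U}) :
  f (S :|: O) - f S <= \sum_(e in O) (f (e |: S) - f S).
Proof.
elim: {O}#|O| {-2}O (erefl #|O|) => [|m IH] O cO.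
  by rewrite (cards0_eq cO) setU0 subrr big_set0.
have /set0Pn[e eO] : O != set0 by rewrite -card_gt0 cO.
rewrite (big_setD1 _ eO) /=.
have /IH le1 : #|O :\ e| = m by apply/eqP; rewrite -eqSS -cO (cardsD1 e O) eO.
have le2 := @marginal_le e S (S :|: O :\ e) (subsetUl _ _).
have -> : S :|: O = e |: (S :|: O :\ e) by rewrite setUCA setD1K.
by rewrite -(subrKA (f (S :|: O :\ e)) (f _)); apply: lerD.
Qed.

(** By diminishing returns, deleting [d] costs [S] at most what it costs a subset [D] containing
    [d]; along a chain of deletions the latter costs telescope. *)
Lemma sum_removal_le (S : {set U}) :
  \sum_(d in S) (f S - f (S :\ d)) <= f S - f set0.
Proof.
suff H : forall m (D : {set U}), #|D| = m -> D \subset S ->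
    \sum_(d in D) (f S - f (S :\ d)) <= f D - f set0 by exact: (H #|S|).
elim=> [|m IH] D cD DS; first by rewrite (cards0_eq cD) subrr big_set0.
have /set0Pn[d dD] : D != set0 by rewrite -card_gt0 cD.
rewrite (big_setD1 _ dD) /= -(subrKA (f (D :\ d)) (f D)); apply: lerD.
  have /marginal_le DdSd : D :\ d \subset S :\ d by exact: setSD.
  by have := DdSd d; rewrite (setD1K dD) (setD1K (subsetP DS _ dD)).
apply: IH; last by apply: subset_trans DS; exact: subsetDl.
by apply/eqP; rewrite -eqSS -cD (cardsD1 d D) dD.
Qed.

Variable M : matroid U.

(* Replaces Brualdi's perfect matching between O and S by a comparison of level
   sets: the items of O whose loss [u] is at least [tau] are spanned by the
   items of S of weight at least [tau]. *)
Lemma sum_swap_gain (S O : {set U}) (G : U -> R) :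
  (forall A, 0 <= f A) -> indep M S -> indep M O ->
  (forall e, 0 <= G e) ->
  (forall e, e \notin S -> indep M (e |: S) -> f (e |: S) - f S <= G e) ->
  (forall e d, e \notin S -> d \in S -> indep M (e |: (S :\ d)) ->
     f (e |: (S :\ d)) - f S <= G e) ->
  f O - 2 * f S <= \sum_(e in O) G e.
Proof.
move=> f0 iS iO G0 Gfree Gswap.
(* Chosen so that [u e <= w d] whenever [e] may replace [d], since the marginal of [e] over [S] is
   at most the one over [S :\ d]. *)
pose u e := f (e |: S) - f S - G e; pose w d := f S - f (S :\ d).
have uw : \sum_(e in O) u e <= \sum_(d in S) w d.
  apply: sum_le_level_sets => [d _|tau tau0].
    by rewrite subr_ge0 mono // subsetDl.
  rewrite leqNgt; apply/negP => lt.
  have iEtau : indep M [set e in O | tau <= u e].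
    by apply: indep_subset iO; apply/subsetP => x; rewrite inE => /andP[].
  have iDtau : indep M [set d in S | tau <= w d].
    by apply: indep_subset iS; apply/subsetP => x; rewrite inE => /andP[].
  have [e] := indep_augment iDtau iEtau lt.
  rewrite 3!inE => /andP[_ /andP[eO ue]] iD.
  have eS : e \notin S.
    apply/negP => eS; move: ue; rewrite /u (_ : _ |: S = S).
      by rewrite subrr sub0r => /(lt_le_trans tau0); rewrite oppr_gt0 ltNge G0.
    by apply/setUidPr; rewrite sub1set.
  (* [B] contains [e] and all items of [S] of weight at least [tau], and is no smaller than [S].
     Either [S] lies in [B] and [e] can be added freely, or [B] is [S] with [e] in place of one item
     lighter than [tau]; both contradict [tau <= u e]. *)
  have [B [iB DB BS cB]] := indep_extend iD iS.
  have eB : e \in B by apply: (subsetP DB); rewrite !inE eqxx.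
  have BeS : B \subset e |: S.
    apply: subset_trans BS _; rewrite -setUA setUS // subUset subxx andbT.
    by apply/subsetP => x; rewrite inE => /andP[].
  have Be : B = e |: (B :\ e) by rewrite setD1K.
  have BS' : B :\ e \subset S.
    by apply/subsetP => x /setD1P[xe /(subsetP BeS)]; rewrite !inE (negPf xe).
  have [/subsetP SB|/subsetPn[d dS dB]] := boolP (S \subset B).
    have iSe : indep M (e |: S).
      by apply: indep_subset iB; apply/subsetP => x /setU1P[->|/SB].
    have := Gfree _ eS iSe; rewrite -subr_le0 => /(le_trans ue).
    by rewrite leNgt tau0.
  have defB : B :\ e = S :\ d.
    apply/eqP; rewrite eqEcard; apply/andP; split.
      apply/subsetP => x xB; rewrite !inE (subsetP BS') // andbT.
      by apply: contraNneq dB => <-; case/setD1P: xB.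
    by move: cB; rewrite (cardsD1 e B) eB (cardsD1 d S) dS !add1n ltnS.
  have wd : w d < tau.
    rewrite ltNge; apply: contra dB => wd; apply: (subsetP DB).
    by rewrite !inE dS wd orbT.
  have iSd : indep M (e |: S :\ d) by rewrite -defB -Be.
  have := Gswap _ _ eS dS iSd.
  have := @marginal_le e _ _ (subsetDl S [set d]).
  move: ue wd; rewrite /u /w => h1 h2 h3 h4.
  by lra.
(* Marginals over [S] sum to at least [f O - f S], and to the gains plus the sum of [u], which is at
   most that of [w], hence at most [f S]. *)
have h1 := sum_removal_le S.
have h2 := sum_marginal_ge S O.
have h3 : f O <= f (S :|: O) by apply: mono; rewrite subsetUr.
move: uw; rewrite sumrB; have := f0 set0; lra.
Qed.

End Submodular.

(** * Local search over windows *)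

Section LocalSearch.
Variables (R : realType) (X : eqType) (val : seq X -> R) (ok : pred (seq X)).

Definition swaps (S : seq X) (e : X) : seq (seq X) :=
  rcons S e :: [seq set_nth e S p e | p <- iota 0 (size S)].

Definition proposals (S : seq X) (e : X) : seq (X * seq X) :=
  [seq (e, T) | T <- swaps S e].
Arguments proposals : simpl never.

Definition keep_better (s : option X * seq X) (c : X * seq X) :=
  if ok c.2 && (val s.2 < val c.2) then (Some c.1, c.2) else s.

Definition scan (S : seq X) (s : option X * seq X) (L : seq X) :=
  foldl keep_better s (flatten (map (proposals S) L)).

Definition remember (H : seq X) (x : option X) : seq X :=
  if x is Some e then if e \in H then H else rcons H e else H.

(** An index beyond the end of [H] recalls nothing, so a uniform index hits each remembered item
    with the same probability whatever the length of [H]. *)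
Definition recall (H : seq X) (r : nat) : seq X := take 1 (drop r H).

(* A state is [(H, S)]: the items ever selected, and the current solution. A
   window is [(r, L)]: the items [L] arrive and the [r]-th item of [H] is
   reconsidered; the best single swap is then carried out. *)
Definition window (HS : seq X * seq X) (w : nat * seq X) :=
  let s := scan HS.2 (None, HS.2) (recall HS.1 w.1 ++ w.2) in
  (remember HS.1 s.1, s.2).

Definition process (ws : seq (nat * seq X)) := foldl window ([::], [::]) ws.

Lemma foldl_keep_better s cs (s' := foldl keep_better s cs) :
  s' = s \/ exists c, [/\ c \in cs, s' = (Some c.1, c.2), ok c.2
                        & val s.2 < val c.2].
Proof.
rewrite {}/s'; elim: cs s => [|c cs IH] s /=; first by left.
have [-> | [c' [c'cs -> okc' lt]]] := IH (keep_better s c).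
  rewrite /keep_better; case: ifP => [/andP[okc lt]|_]; last by left.
  by right; exists c; rewrite mem_head.
right; exists c'; split; rewrite // ?in_cons ?c'cs ?orbT //.
apply: le_lt_trans lt; rewrite /keep_better; case: ifP => // /andP[_].
exact: ltW.
Qed.

Lemma foldl_keep_better_ge s cs : val s.2 <= val (foldl keep_better s cs).2.
Proof.
by have [->//|[c [_ -> _ /ltW]]] := foldl_keep_better s cs.
Qed.

Lemma foldl_keep_better_mem_ge s cs c : c \in cs -> ok c.2 ->
  val c.2 <= val (foldl keep_better s cs).2.
Proof.
elim: cs s => //= c' cs IH s; rewrite in_cons => /predU1P[<-|/IH]; last exact.
move=> okc; apply: le_trans (foldl_keep_better_ge _ _).
by rewrite /keep_better okc /=; case: ltP.
Qed.

(** A candidate that beats [s2] also beats [s1], and from then on the runs coincide; one that beats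
    only [s1] leaves the order of the two values intact. *)
Lemma foldl_keep_better_restart s1 s2 cs : val s1.2 <= val s2.2 ->
  foldl keep_better s2 cs = s2 \/
  foldl keep_better s2 cs = foldl keep_better s1 cs.
Proof.
elim: cs s1 s2 => [|c cs IH] s1 s2 le12 /=; first by left.
have kE s : keep_better s c =
  if ok c.2 && (val s.2 < val c.2) then (Some c.1, c.2) else s by [].
rewrite !{}kE; case: (boolP (ok c.2)) => [okc|_] /=; last exact: IH.
case: (ltP (val s2.2) (val c.2)) => [lt2|le2].
  by rewrite (le_lt_trans le12 lt2); right.
by case: ifP => _; apply: IH.
Qed.

Lemma mem_proposals S e c : c \in proposals S e -> c.1 = e.
Proof. by case/mapP => T _ ->. Qed.

Lemma swaps_subset S e T : T \in swaps S e -> {subset T <= e :: S}.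
Proof.
rewrite in_cons => /predU1P[->|]; first by move=> x; rewrite mem_rcons.
case/mapP => p; rewrite mem_iota => /andP[_ pS] -> x /(nthP e)[i].
rewrite size_set_nth nth_set_nth /= => _ <-; case: eqP => _.
  exact: mem_head.
have [iS|Si] := ltnP i (size S); first by rewrite in_cons mem_nth ?orbT.
by rewrite nth_default ?mem_head.
Qed.

Lemma scan_cons S s x L :
  scan S s (x :: L) = scan S (foldl keep_better s (proposals S x)) L.
Proof. exact: foldl_cat. Qed.

(** A losing item leaves no trace: the rest of the scan either keeps a proposal of [e], which would
    make [e] the winner, or ends as if the proposals of [e] had not been made. *)
Lemma scan_filter e S s L : (scan S s L).1 != Some e ->
  scan S s [seq x <- L | x != e] = scan S s L.
Proof.
elim: L s => // x L IH s; rewrite [filter _ _]/=.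
have [->|xe] := eqVneq x e; rewrite /= ?scan_cons; last exact: IH.
set s2 := foldl _ s _ => ne.
have [s2s|[c [/mem_proposals ce s2c _ /ltW le]]] :=
  foldl_keep_better s (proposals S e); first by move: ne; rewrite /s2 s2s => /IH.
have le2 : val s.2 <= val s2.2 by rewrite /s2 s2c.
have [h|h] := foldl_keep_better_restart (flatten (map (proposals S) L)) le2.
  by move: ne; rewrite /scan h /s2 s2c /= ce eqxx.
by move: ne; rewrite [scan S s2 L]h => /IH.
Qed.

Lemma scan_ge S s L : val s.2 <= val (scan S s L).2.
Proof. exact: foldl_keep_better_ge. Qed.

Lemma scan_mem_ge S s L e T : e \in L -> T \in swaps S e -> ok T ->
  val T <= val (scan S s L).2.
Proof.
move=> eL TS okT; apply: (@foldl_keep_better_mem_ge _ _ (e, T)) => //.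
by apply/flatten_mapP; exists e; rewrite // map_f.
Qed.

Lemma scan_mem_le S L e : e \in L ->
  val (scan S (None, S) [:: e]).2 <= val (scan S (None, S) L).2.
Proof.
move=> eL; rewrite scan_cons.
rewrite -[scan _ _ [::]]/(foldl keep_better (None, S) (proposals S e)).
have [->|[c [cS -> okc _]]] := foldl_keep_better (None, S) (proposals S e).
  exact: scan_ge.
case/mapP: cS okc => T TS -> /= okT; exact: scan_mem_ge eL TS okT.
Qed.

Lemma scan_ok S s L : ok s.2 -> ok (scan S s L).2.
Proof.
rewrite /scan; case: (foldl_keep_better s (flatten (map (proposals S) L))).
  by move=> ->.
by case=> c [_ -> okc _].
Qed.

Lemma remember_size H x : (size (remember H x) <= (size H).+1)%N.
Proof. by case: x => [e|] //=; case: ifP; rewrite ?size_rcons. Qed.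

Lemma remember_sub H x : {subset H <= remember H x}.
Proof.
case: x => [e|] //= y yH; case: ifP => // _.
by rewrite mem_rcons in_cons yH orbT.
Qed.

Lemma remember_mem H e : e \in remember H (Some e).
Proof. by rewrite /=; case: ifP => // _; rewrite mem_rcons mem_head. Qed.

Lemma recall_mem H r e : e \in recall H r -> e \in H.
Proof. by move/mem_take/mem_drop. Qed.

Lemma recall_index H e : e \in H -> e \in recall H (index e H).
Proof. by move=> eH; rewrite /recall drop_index //= take0 mem_head. Qed.

End LocalSearch.

Lemma flatten_map_proposals (X Y : eqType) (h : X -> Y) S L :
  flatten (map (proposals (map h S)) (map h L)) =
  [seq (h c.1, map h c.2) | c <- flatten (map (proposals S) L)].
Proof.
elim: L => //= x L ->; rewrite map_cat; congr (_ :: _ ++ _).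
  by rewrite map_rcons.
rewrite /proposals -!map_comp size_map; apply/eq_in_map => p /=.
rewrite mem_iota add0n /= => pS; congr (_, _).
apply: (@eq_from_nth _ (h x)) => [|i].
  by rewrite size_map !size_set_nth size_map.
rewrite size_set_nth size_map => iS.
have iS' : (i < size S)%N by rewrite (maxn_idPr pS) in iS.
rewrite (nth_map x) ?size_set_nth // !nth_set_nth /=.
by case: eqP => // _; rewrite (nth_map x).
Qed.

(** * Equivariance under injective relabelling, to pass from arrival times to items *)

Section Relabel.
Variables (R : realType) (X Y : eqType) (h : X -> Y) (hinj : injective h).
Variables (val : seq Y -> R) (ok : pred (seq Y)).

Lemma window_map H S w :
  window val ok (map h H, map h S) (w.1, map h w.2) =
  (fun HS => (map h HS.1, map h HS.2))
    (window (val \o map h) (ok \o map h) (H, S) w).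
Proof.
rewrite /window /=.
have -> : recall (map h H) w.1 ++ map h w.2 = map h (recall H w.1 ++ w.2).
  by rewrite map_cat /recall map_take map_drop.
set L := recall H w.1 ++ w.2.
suff /(_ (None, S)) /= -> : forall s,
    scan val ok (map h S) (omap h s.1, map h s.2) (map h L) =
    (fun s' => (omap h s'.1, map h s'.2))
      (scan (val \o map h) (ok \o map h) S s L).
  case: (scan _ _ S _ _) => -[e|] T //=; rewrite mem_map //.
  by case: ifP; rewrite ?map_rcons.
move=> s; rewrite /scan flatten_map_proposals.
elim: (flatten _) s => //= c cs IH s; rewrite -IH; congr foldl.
by rewrite /keep_better /=; case: ifP.
Qed.

Lemma process_map ws :
  process val ok [seq (w.1, map h w.2) | w <- ws] =
  (fun HS => (map h HS.1, map h HS.2))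
    (process (val \o map h) (ok \o map h) ws).
Proof.
suff gen : forall HS, foldl (window val ok) (map h HS.1, map h HS.2)
    [seq (w.1, map h w.2) | w <- ws] = (fun HS => (map h HS.1, map h HS.2))
    (foldl (window (val \o map h) (ok \o map h)) HS ws) by exact: (gen ([::], [::])).
elim: ws => //= w ws IH [H S]; rewrite window_map.
exact: IH.
Qed.

End Relabel.

(** * Expected gain of a window *)

Section Resample.
Variables (R : realDomainType) (C T : finType).
Implicit Types (om : {ffun C -> T}) (c : C) (u : T).

Definition upd om c u : {ffun C -> T} := [ffun x => if x == c then u else om x].

Lemma upd_same om c u : upd om c u c = u.
Proof. by rewrite ffunE eqxx. Qed.

Lemma upd_other om c u x : x != c -> upd om c u x = om x.
Proof. by rewrite ffunE => /negPf ->. Qed.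

Lemma upd_upd om c u v : upd (upd om c u) c v = upd om c v.
Proof. by apply/ffunP => x; rewrite !ffunE; case: (x == c). Qed.

Lemma upd_id om c : upd om c (om c) = om.
Proof. by apply/ffunP => x; rewrite !ffunE; case: eqP => [->|]. Qed.

Variables (c : C) (v : {ffun C -> T} -> T).
Hypothesis v_upd : forall om u, v (upd om c u) = v om.

(** Since [v] ignores coordinate [c], overwriting it maps the assignments with [om c = v om]
    bijectively to those with [om c = u]: given the other coordinates, [om c] is uniform. *)
Lemma sum_resample u (Phi : {ffun C -> T} -> R) :
  \sum_(om : {ffun C -> T} | om c == u) Phi om =
  \sum_(om : {ffun C -> T} | om c == v om) Phi (upd om c u).
Proof.
rewrite (reindex_onto (fun om : {ffun C -> T} => upd om c u)
  (fun om : {ffun C -> T} => upd om c (v om))) /=.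
  apply: eq_bigl => om; rewrite upd_same eqxx v_upd upd_upd /=.
  by apply/eqP/eqP => [<-|<-]; rewrite ?upd_same ?v_upd ?upd_id.
by move=> om /eqP <-; rewrite upd_upd upd_id.
Qed.

Variable V : {set T}.

Let sum_V (Phi : {ffun C -> T} -> R) :
  \sum_(om : {ffun C -> T} | om c \in V) Phi om =
  \sum_(u in V) \sum_(om : {ffun C -> T} | om c == v om) Phi (upd om c u).
Proof.
rewrite (partition_big (fun om : {ffun C -> T} => om c) (mem V)) //=.
apply: eq_bigr => u uV.
rewrite -sum_resample; apply: eq_bigl => om.
by case: eqP => [->|]; rewrite ?uV ?andbF.
Qed.

Lemma sum_resample_le (Phi Psi : {ffun C -> T} -> R) :
  (forall om u, om c = v om -> u \in V -> Phi (upd om c u) <= Psi om) ->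
  \sum_(om : {ffun C -> T} | om c \in V) Phi om <=
  (\sum_(om : {ffun C -> T} | om c == v om) Psi om) *+ #|V|.
Proof.
move=> le; rewrite sum_V -sumr_const; apply: ler_sum => u uV.
by apply: ler_sum => om /eqP vom; apply: le.
Qed.

Lemma sum_resample_ge (Phi Psi : {ffun C -> T} -> R) :
  (forall om u, om c = v om -> u \in V -> Psi om <= Phi (upd om c u)) ->
  (\sum_(om : {ffun C -> T} | om c == v om) Psi om) *+ #|V| <=
  \sum_(om : {ffun C -> T} | om c \in V) Phi om.
Proof.
move=> le; rewrite sum_V -sumr_const; apply: ler_sum => u uV.
by apply: ler_sum => om /eqP vom; apply: le.
Qed.

End Resample.

(** * The window process with independent uniform labels *)

Section Analysis.
Variables (R : realType) (U : finType) (M : matroid U) (f : {set U} -> R).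
Hypotheses (f_ge0 : forall A, 0 <= f A) (f_mono : monotone_setfun f).
Hypothesis f_sub : submodular f.

Definition value_of (s : seq U) : R := f [set x in s].
Definition feasible (s : seq U) : bool := uniq s && indep M [set x in s].

Definition gain (S : seq U) (e : U) : R :=
  value_of (scan value_of feasible S (None, S) [:: e]).2 - value_of S.

Lemma gain_ge0 S e : 0 <= gain S e.
Proof. by rewrite subr_ge0; exact: (scan_ge _ _ _ (None, S)). Qed.

Lemma gain_ge S e T : T \in swaps S e -> feasible T ->
  value_of T - value_of S <= gain S e.
Proof.
by move=> TS fT; rewrite lerD2r; apply: scan_mem_ge TS fT; rewrite mem_head.
Qed.

Lemma sum_gain_ge (S : seq U) (O : {set U}) : feasible S -> indep M O ->
  f O - 2 * value_of S <= \sum_(e in O) gain S e.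
Proof.
move=> /andP[uS iS] iO; apply: sum_swap_gain iS iO _ _ _ => //.
- exact: gain_ge0.
- move=> e; rewrite inE => eS iSe.
  have eT : [set x in rcons S e] = e |: [set x in S].
    by apply/setP => x; rewrite !inE mem_rcons.
  rewrite -eT; apply: gain_ge; first exact: mem_head.
  by rewrite /feasible rcons_uniq eS uS eT.
move=> e d; rewrite !inE => eS dS; case/splitPr: dS uS eS => p1 p2 uS eS.
have permT x : perm_eq (p1 ++ x :: p2) (x :: p1 ++ p2).
  by rewrite perm_sym -cat1s perm_catCA.
have eT : [set x in p1 ++ e :: p2] = e |: [set x in p1 ++ d :: p2] :\ d.
  move: uS; rewrite (perm_uniq (permT d)) /= => /andP[dp _].
  apply/setP => x; rewrite !inE (perm_mem (permT e)) (perm_mem (permT d)) !in_cons.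
  by have [->|] := eqVneq x d; rewrite //= ?orbF (negPf dp) ?orbF.
rewrite -eT => iT; apply: gain_ge.
  rewrite in_cons; apply/orP; right; apply/mapP; exists (size p1).
    by rewrite mem_iota size_cat /= -addSnnS leq_addr.
  rewrite set_nthE size_cat /= -addSnnS leq_addr take_size_cat //.
  by rewrite drop_cat ltnNge leqnSn /= subSnn /= drop0.
rewrite /feasible iT andbT (perm_uniq (permT e)) /=.
move: uS eS; rewrite (perm_uniq (permT d)) (perm_mem (permT d)) /= => /andP[_ ->].
by rewrite in_cons negb_or andbT => /andP[_ ->].
Qed.

Variables (w : nat) (ord : seq U).
Hypothesis mem_ord : forall x, x \in ord.

Notation W := 'I_w.+1.
Notation Omega := {ffun U + W -> W}.
Implicit Types (om : Omega) (j : nat) (J : W).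

(* The label [om (inl x)] is the window in which x arrives, and [om (inr j)] is
   the random index into the remembered items used in window j. *)
Definition window_data om j : nat * seq U :=
  (val (om (inr (inord j))), [seq x <- ord | om (inl x) == j :> nat]).

Definition state om j := process value_of feasible (mkseq (window_data om) j).

Lemma stateS om j :
  state om j.+1 = window value_of feasible (state om j) (window_data om j).
Proof. by rewrite /state /process mkseqS foldl_rcons. Qed.

Lemma state_size om j : (size (state om j).1 <= j)%N.
Proof.
by elim: j => // j IH; rewrite stateS (leq_trans (remember_size _ _)).
Qed.

Lemma state_feasible om j : feasible (state om j).2.
Proof.
elim: j => [|j IH]; last by rewrite stateS scan_ok.
rewrite /feasible /= (_ : [set x in _] = set0) ?indep_set0 //.
Qed.

Lemma state_value_le om i j : (i <= j)%N ->
  value_of (state om i).2 <= value_of (state om j).2.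
Proof.
elim: j => [|j IH]; first by rewrite leqn0 => /eqP ->.
rewrite leq_eqVlt => /predU1P[-> //|/IH/le_trans]; apply.
by rewrite stateS; apply: (scan_ge _ _ _ (None, _)).
Qed.

(** Induction over windows: an item absent from the list after a window neither was remembered
    before it nor won it, so [scan_filter] may delete it there, which is the effect of giving it a
    later label. *)
Lemma state_move_item om j e (u : W) : e \notin (state om j).1 -> (j <= u)%N ->
  state (upd om (inl e) u) j = state om j.
Proof.
elim: j => [|j IH] // eH ju.
have [eHj ne] : e \notin (state om j).1 /\
    (scan value_of feasible (state om j).2 (None, (state om j).2)
     (recall (state om j).1 (window_data om j).1 ++ (window_data om j).2)).1
    != Some e.
  split; first by apply: contra eH; rewrite stateS; apply: remember_sub.
  by apply: contra eH; rewrite stateS /window => /eqP ->; apply: remember_mem.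
rewrite !stateS IH ?(ltnW ju) // /window -(scan_filter ne) filter_cat.
have -> : (window_data (upd om (inl e) u) j).1 = (window_data om j).1.
  by rewrite /= upd_other.
have -> : [seq x <- recall (state om j).1 (window_data om j).1 | x != e] =
    recall (state om j).1 (window_data om j).1.
  apply/all_filterP/allP => x /recall_mem xH.
  by apply: contraNneq eHj => <-.
have -> // : (window_data (upd om (inl e) u) j).2 =
    [seq x <- (window_data om j).2 | x != e].
rewrite /= -filter_predI; apply: eq_filter => x /=.
have [->|xe] := eqVneq x e; first by rewrite upd_same gtn_eqF.
by rewrite upd_other //= (inj_eq inl_inj).
Qed.

Lemma state_move_draw om J u : state (upd om (inr J) u) J = state om J.
Proof.
rewrite /state; congr (process _ _); apply/eq_in_map => i.
rewrite mem_iota add0n /= => iJ; rewrite /window_data.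
rewrite upd_other; last first.
  rewrite (inj_eq inr_inj) -val_eqE /= inordK ?ltn_eqF //.
  exact: ltn_trans (ltn_ord J).
by congr (_, _); apply: eq_filter => x; rewrite upd_other.
Qed.


(** The coordinate of [om] inspected to decide whether [e] is a candidate in window [J]; [target] is
    the value that makes it one. *)
Definition slot om J e : U + W := if e \in (state om J).1 then inr J else inl e.

Definition target om J e : W :=
  if e \in (state om J).1 then inord (index e (state om J).1) else J.

Definition offered om J e : bool := om (slot om J e) == target om J e.

Lemma index_inord om J e :
  (inord (index e (state om J).1) : W) = index e (state om J).1 :> nat.
Proof.
rewrite inordK // ltnS (leq_trans (index_size _ _)) //.
by rewrite (leq_trans (state_size _ _)) // -ltnS.
Qed.

Lemma offered_gain om J e : offered om J e ->
  gain (state om J).2 e <=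
  value_of (state om J.+1).2 - value_of (state om J).2.
Proof.
move=> off; rewrite lerD2r stateS; apply: scan_mem_le.
rewrite mem_cat /= inord_val mem_filter mem_ord andbT.
move: off; rewrite /offered /slot /target; case: ifPn => eH /eqP ->.
  by rewrite index_inord recall_index.
by rewrite eqxx orbT.
Qed.

Lemma sum_offered J e (Psi : Omega -> R) :
  \sum_om (offered om J e)%:R * Psi om =
  \sum_(om : Omega | om (inr J) == inord (index e (state om J).1))
     (e \in (state om J).1)%:R * Psi om +
  \sum_(om : Omega | om (inl e) == J) (e \notin (state om J).1)%:R * Psi om.
Proof.
rewrite [in RHS]big_mkcond [X in _ + X]big_mkcond -big_split /=.
apply: eq_bigr => om _; rewrite /offered /slot /target; case: ifP => eH /=.
  by rewrite mul0r if_same addr0; case: eqP; rewrite ?mul0r.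
by rewrite mul0r if_same add0r; case: eqP; rewrite ?mul0r.
Qed.

(* Moving an item that was never selected to window J, or redrawing the index
   used in window J, preserves the state before window J. *)
Lemma sum_offered_gain_ge J e :
  \sum_(om : Omega) gain (state om J).2 e <=
  (\sum_(om : Omega) (offered om J e)%:R * gain (state om J).2 e) *+ w.+1.
Proof.
have to_all (c : U + W) (Phi : Omega -> R) :
    \sum_(om : Omega | om c \in [set: W]) Phi om = \sum_om Phi om.
  by apply: eq_bigl => om; rewrite inE.
pose Phi1 om := (e \in (state om J).1)%:R * gain (state om J).2 e.
pose Phi2 om := (e \notin (state om J).1)%:R * gain (state om J).2 e.
have le1 : \sum_om Phi1 om <= (\sum_(om : Omega |
    om (inr J) == inord (index e (state om J).1)) Phi1 om) *+ w.+1.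
  rewrite -(to_all (inr J)) -[X in _ *+ X](card_ord w.+1) -cardsT.
  apply: sum_resample_le => [om u|om u _ _]; rewrite ?state_move_draw //.
  by rewrite /Phi1 state_move_draw.
have le2 : \sum_om Phi2 om <=
    (\sum_(om : Omega | om (inl e) == J) Phi2 om) *+ w.+1.
  rewrite -(to_all (inl e)) -[X in _ *+ X](card_ord w.+1) -cardsT.
  apply: (sum_resample_le (v := fun=> J)) => // om u omJ _; rewrite /Phi2.
  have [eH|eH] := boolP (e \in (state (upd om (inl e) u) J).1).
    by rewrite mul0r mulr_ge0 ?ler0n ?gain_ge0.
  have := state_move_item eH (leqnn J); rewrite upd_upd -{1}omJ upd_id => ->.
  by rewrite eH.
rewrite sum_offered mulrnDl; apply: le_trans (lerD le1 le2).
rewrite -big_split /=; apply: ler_sum => om _; rewrite /Phi1 /Phi2.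
by case: (e \in _); rewrite /= mul0r mul1r ?addr0 ?add0r.
Qed.

Lemma card_ord_ge J : #|[set u : W | (J <= u)%N]| = (w.+1 - J)%N.
Proof.
rewrite cardsE -sum1_card -(big_mkord (fun u => J <= u)%N (fun=> 1%N)).
rewrite (@big_cat_nat _ _ _ J) ?(ltnW (ltn_ord J)) //= big_nat_cond big1.
  rewrite add0n big_nat_cond (eq_bigl (fun i => J <= i < w.+1)%N).
    by rewrite -big_nat sum_nat_const_nat muln1.
  by move=> i; case: (J <= i)%N; rewrite ?andbF ?andbT.
by move=> i /andP[/andP[_ iJ]]; rewrite leqNgt iJ.
Qed.

(** If [e'] is unselected, every label from [J] on gives the same state and the same answer for [e].
    If [e'] is remembered, the index of window [J] is redrawn instead; when [e] is remembered too,
    one index cannot hit both. *)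
Lemma sum_offered_pair_le J e e' : e != e' ->
  (\sum_(om : Omega) (offered om J e')%:R *
      ((offered om J e)%:R * gain (state om J).2 e)) *+ (w.+1 - J) <=
  \sum_(om : Omega) (offered om J e)%:R * gain (state om J).2 e.
Proof.
move=> ee'; pose Psi om := (offered om J e)%:R * gain (state om J).2 e.
have Psi0 om : 0 <= Psi om by rewrite mulr_ge0 ?ler0n ?gain_ge0.
rewrite [X in X *+ _](sum_offered J e' Psi) mulrnDl -card_ord_ge.
pose Phi1 om := (e' \in (state om J).1)%:R * Psi om.
pose Phi2 om := (e' \notin (state om J).1)%:R * Psi om.
apply: (@le_trans _ _ (\sum_om Phi1 om + \sum_om Phi2 om)); last first.
  rewrite -big_split /=; apply: ler_sum => om _; rewrite /Phi1 /Phi2.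
  by case: (e' \in _); rewrite /= mul0r mul1r ?addr0 ?add0r.
have le_all (c : U + W) (Phi : Omega -> R) : (forall om, 0 <= Phi om) ->
    \sum_(om : Omega | om c \in [set u : W | (J <= u)%N]) Phi om <=
    \sum_om Phi om.
  move=> Phi0; rewrite [leRHS](bigID
    (fun om : Omega => om c \in [set u : W | (J <= u)%N])) /= lerDl.
  exact: sumr_ge0.
apply: lerD; apply: le_trans (le_all _ _ _); last 2 first.
- apply: sum_resample_ge => // om u _; rewrite inE => Ju.
  have [eH|eH] := boolP (e' \in (state om J).1); first by rewrite mul0r mulr_ge0.
  rewrite /Phi2 /Psi /offered /slot /target state_move_item // eH.
  by rewrite upd_other //; case: ifP => // _; rewrite (inj_eq inl_inj).
- by move=> om; rewrite mulr_ge0.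
- apply: sum_resample_ge => [om u|om u omJ _]; first by rewrite state_move_draw.
  have [eH'|eH'] := boolP (e' \in (state om J).1); last first.
    by rewrite mul0r mulr_ge0.
  rewrite /Phi1 /Psi /offered /slot /target state_move_draw eH' !mul1r.
  case: ifP => eH; last by rewrite upd_other.
  rewrite omJ -val_eqE /= !index_inord eq_sym (inj_in_eq (@index_inj _ e (state om J).1)) //.
  by rewrite (negPf ee') mul0r mulr_ge0 ?ler0n ?gain_ge0.
by move=> om; rewrite mulr_ge0.
Qed.

(** A Bonferroni inequality. Fix one [e] of [O] in [Y]: its own term is at most [d], and the term of
    every other item is cancelled by its pair with [e]. *)
Lemma sum_unique_le (O : {set U}) (Y : pred U) (g : U -> R) (d : R) :
  0 <= d -> (forall e, 0 <= g e) -> (forall e, Y e -> g e <= d) ->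
  \sum_(e in O) ((Y e)%:R * g e -
     \sum_(e' in O :\ e) (Y e')%:R * ((Y e)%:R * g e)) <= d.
Proof.
move=> d0 g0 gd.
have [/exists_inP[e eO Ye]|] := boolP [exists e in O, Y e]; last first.
  rewrite negb_exists_in => /forall_inP nY; rewrite big1 // => e /nY /negPf ->.
  by rewrite mul0r big1 ?subr0 // => e' _; rewrite mulr0.
rewrite (big_setD1 _ eO) /= -[leRHS]addr0; apply: lerD.
  rewrite Ye mul1r lerBlDr -[leLHS]addr0 lerD ?gd //.
  by apply: sumr_ge0 => e' _; rewrite mulr_ge0.
apply: sumr_le0 => e' /setD1P[e'e e'O].
rewrite (big_setD1 e) /= ?inE 1?eq_sym ?e'e // Ye mul1r opprD addrA subrr sub0r.
by rewrite oppr_le0; apply: sumr_ge0 => e2 _; rewrite !mulr_ge0.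
Qed.

Definition total_value j : R := \sum_(om : Omega) value_of (state om j).2.

Lemma total_value_le i j : (i <= j)%N -> total_value i <= total_value j.
Proof. by move=> ij; apply: ler_sum => om _; apply: state_value_le. Qed.

Lemma total_value_step (O : {set U}) J : indep M O -> (#|O| <= w.+1 - J)%N ->
  ((w.+1 - J) - #|O|)%:R * (#|Omega|%:R * f O - 2 * total_value J) <=
  (w.+1 - J)%:R * (w.+1%:R * (total_value J.+1 - total_value J)).
Proof.
move=> iO cO; set n := (w.+1 - J)%N.
pose a e := \sum_(om : Omega) (offered om J e)%:R * gain (state om J).2 e.
pose b e e' := \sum_(om : Omega) (offered om J e')%:R *
      ((offered om J e)%:R * gain (state om J).2 e).
have gains : #|Omega|%:R * f O - 2 * total_value J <= w.+1%:R * \sum_(e in O) a e.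
  rewrite /total_value mulr_sumr mulr_natl -sumr_const -sumrB.
  apply: (@le_trans _ _ (\sum_(om : Omega) \sum_(e in O) gain (state om J).2 e)).
    by apply: ler_sum => om _; apply: sum_gain_ge => //; apply: state_feasible.
  rewrite exchange_big mulr_sumr; apply: ler_sum => e _ /=.
  by rewrite mulr_natl sum_offered_gain_ge.
have step : \sum_(e in O) (a e - \sum_(e' in O :\ e) b e e') <=
    total_value J.+1 - total_value J.
  rewrite /total_value -sumrB.
  rewrite (eq_bigr (fun e => \sum_(om : Omega)
     ((offered om J e)%:R * gain (state om J).2 e - \sum_(e' in O :\ e)
       (offered om J e')%:R * ((offered om J e)%:R * gain (state om J).2 e)))).
    rewrite exchange_big; apply: ler_sum => om _ /=.
    apply: sum_unique_le => [|e|e]; [|exact: gain_ge0|exact: offered_gain].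
    by rewrite subr_ge0 state_value_le.
  by move=> e _; rewrite sumrB; congr (_ - _); rewrite exchange_big.
(* Each of the [#|O| - 1] pairs of [e] costs at most [a e / n]; one more [a e] is given away to
   round the count up to [#|O|]. *)
have pairs : (n - #|O|)%:R * \sum_(e in O) a e <=
    n%:R * \sum_(e in O) (a e - \sum_(e' in O :\ e) b e e').
  rewrite !mulr_sumr; apply: ler_sum => e eO.
  rewrite natrB // mulrBl mulrBr lerD2l lerN2 mulr_sumr mulr_natl.
  rewrite [in leRHS](cardsD1 e) eO mulrS -sumr_const addrC -[leLHS]addr0.
  apply: lerD; last first.
    by apply: sumr_ge0 => om _; rewrite mulr_ge0 ?ler0n ?gain_ge0.
  apply: ler_sum => e' /setD1P[e'e _].
  by rewrite mulr_natl sum_offered_pair_le // eq_sym.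
apply: le_trans (ler_wpM2l (ler0n _ _) gains) _.
rewrite mulrCA [leRHS]mulrCA ler_wpM2l //.
by apply: le_trans pairs _; rewrite ler_wpM2l.
Qed.

End Analysis.

(** * The streaming program *)

Section Program.
Variables (R : realType) (n : nat).
Notation time := 'I_n.

(** The value of the current best is queried anew for each candidate, hence two evaluations per
    candidate. *)
Fixpoint try_all (cs : seq (time * seq time)) (s : option time * seq time)
    (cont : option time * seq time -> streaming_alg R n) : streaming_alg R n :=
  if cs is c :: cs' then
    Value [set x in s.2] (fun v : R => Value [set x in c.2] (fun v' : R =>
    Indep [set x in c.2] (fun b =>
      try_all cs' (if (uniq c.2 && b) && (v < v') then (Some c.1, c.2) else s)
        cont)))
  else cont s.

(** [S] stays in the buffer throughout the window because every proposal is a swap on it; [s] is the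
    best proposal so far with its item. *)
Fixpoint arrivals (H S : seq time) (ts : seq time) (s : option time * seq time)
    (cont : option time * seq time -> streaming_alg R n) : streaming_alg R n :=
  if ts is t :: ts' then
    Next [set x in H ++ S ++ seq_of_opt s.1 ++ s.2]
      (try_all (proposals S t) s (fun s' => arrivals H S ts' s' cont))
  else cont s.

Fixpoint run (ws : seq (nat * seq time)) (H S : seq time) : streaming_alg R n :=
  if ws is w :: ws' then
    try_all (flatten (map (proposals S) (recall H w.1))) (None, S) (fun s =>
    arrivals H S w.2 s (fun s' => run ws' (remember H s'.1) s'.2))
  else Output R [set x in S].

Definition draw (T : finType) (x0 : T) (cont : T -> streaming_alg R n) :=
  @Draw R n #|T|.-1 (fun i => cont (nth x0 (enum T) i)).

Section Semantics.
Variables (U : finType) (M : matroid U) (f : {set U} -> R).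
Variable o : {ffun time -> U}.

Definition time_value (s : seq time) : R := f (o @: [set x in s]).
Definition time_feasible (s : seq time) : bool :=
  uniq s && indep M (o @: [set x in s]).

Notation keep := (keep_better time_value time_feasible).
Notation tscan := (scan time_value time_feasible).
Notation twindow := (window time_value time_feasible).

Lemma mean_try_all cs s cont :
  mean_value M f o (try_all cs s cont) = mean_value M f o (cont (foldl keep s cs)).
Proof. by elim: cs s => //= c cs IH s; rewrite IH. Qed.

Lemma mean_arrivals H S ts s cont :
  mean_value M f o (arrivals H S ts s cont) = mean_value M f o (cont (tscan S s ts)).
Proof.
elim: ts s => // t ts IH s; rewrite scan_cons -IH.
exact: mean_try_all.
Qed.

Lemma mean_run ws H S :
  mean_value M f o (run ws H S) = time_value (foldl twindow (H, S) ws).2.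
Proof.
elim: ws H S => // w ws IH H S; rewrite mean_try_all mean_arrivals IH.
by rewrite /= /window /scan map_cat flatten_cat foldl_cat.
Qed.

Lemma mean_draw (T : finType) (x0 : T) cont :
  mean_value M f o (draw x0 cont) =
  (\sum_x mean_value M f o (cont x)) / #|T|%:R.
Proof.
have T0 : (0 < #|T|)%N by apply/card_gt0P; exists x0.
rewrite /= -(big_mkord xpredT (fun i => mean_value M f o (cont (nth x0 (enum T) i)))).
rewrite prednK // -[in RHS]big_enum [in RHS](big_nth x0) -cardE.
by [].
Qed.

Lemma evals_draw (T : finType) (x0 : T) cont b :
  (forall x, num_evals M f o (cont x) <= b)%N ->
  (num_evals M f o (draw x0 cont) <= b)%N.
Proof. by move=> le_b; apply/bigmax_leqP => i _; apply: le_b. Qed.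

Lemma valid_draw m t B (T : finType) (x0 : T) cont :
  (forall x, valid_run M f o m t B (cont x)) ->
  valid_run M f o m t B (draw x0 cont).
Proof. by move=> val; apply/forallP => i; apply: val. Qed.

Lemma evals_try_all cs s cont :
  num_evals M f o (try_all cs s cont) =
  (2 * size cs + num_evals M f o (cont (foldl keep s cs)))%N.
Proof. by elim: cs s => //= c cs IH s; rewrite IH mulnS. Qed.

Lemma size_proposals (S : seq time) t : size (proposals S t) = (size S).+1.
Proof. by rewrite size_map /= size_map size_iota. Qed.

Lemma size_flatten_proposals (S L : seq time) :
  size (flatten (map (proposals S) L)) = (size L * (size S).+1)%N.
Proof.
rewrite size_flatten /shape -map_comp (eq_map (size_proposals S)).
by elim: L => //= t L ->.
Qed.

Lemma evals_arrivals H S ts s cont :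
  num_evals M f o (arrivals H S ts s cont) =
  (2 * (size ts * (size S).+1) + num_evals M f o (cont (tscan S s ts)))%N.
Proof.
elim: ts s => // t ts IH s; rewrite scan_cons.
transitivity (num_evals M f o (try_all (proposals S t) s
  (fun s' => arrivals H S ts s' cont))) => //.
by rewrite evals_try_all IH size_proposals addnA -mulnDr.
Qed.

Hypothesis o_inj : injective o.

Lemma time_feasible_size s : time_feasible s -> (size s <= rank M)%N.
Proof.
case/andP=> us /indep_card; rewrite card_imset // cardsE.
by rewrite (card_uniqP us).
Qed.

(** A window handles its arrivals and at most one recalled item, each with [(size S).+1] proposals
    of two evaluations. *)
Lemma evals_run ws H S : time_feasible S ->
  (num_evals M f o (run ws H S) <=
   2 * (size (flatten (unzip2 ws)) + size ws) * (rank M).+1)%N.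
Proof.
elim: ws H S => [|w ws IH] H S fS; first by rewrite leq0n.
rewrite [run _ _ _]/= evals_try_all evals_arrivals.
set s := scan _ _ _ _ _.
have fs : time_feasible s.2 by do 2 apply: scan_ok.
have le1 : (size (recall H w.1) <= 1)%N by rewrite size_take_min geq_minl.
have leS := time_feasible_size fS.
rewrite size_flatten_proposals.
rewrite addnA -mulnDr -mulnDl.
apply: (@leq_trans (2 * ((1 + size w.2) * (rank M).+1) + 2 *
    (size (flatten (unzip2 ws)) + size ws) * (rank M).+1)).
  by rewrite leq_add ?IH // leq_mul2l leq_mul ?leq_add2r.
rewrite mulnA -mulnDl -mulnDr /= size_cat; nia.
Qed.

Lemma valid_try_all m t (B : {set time}) (cs : seq (time * seq time))
    (s : option time * seq time) cont :
  {subset s.2 <= B} -> (forall c, c \in cs -> {subset c.2 <= B}) ->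
  valid_run M f o m t B (cont (foldl keep s cs)) ->
  valid_run M f o m t B (try_all cs s cont).
Proof.
have sB (l : seq time) : {subset l <= B} -> [set x in l] \subset B.
  by move=> lB; apply/subsetP => x; rewrite inE => /lB.
elim: cs s => //= c cs IH s ssB csB val.
rewrite !sB //; last by apply: csB; rewrite mem_head.
have csB' c' : c' \in cs -> {subset c'.2 <= B}.
  by move=> c'cs; apply: csB; rewrite in_cons c'cs orbT.
apply: IH => //; case: ifP => // _.
by apply: csB; rewrite mem_head.
Qed.

Lemma valid_Next m (t : time) (B D : {set time}) p :
  valid_run M f o m t B (Next D p) =
  [&& D \subset B, (#|t |: D| <= m)%N & valid_run M f o m t.+1 (t |: D) p].
Proof. by rewrite /= valK. Qed.

(** The buffer holds [H], [S], the best proposal (at most [rank M] items), its item and the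
    newcomer; the last two account for the [2]. *)
Lemma valid_arrivals m t t' (B : {set time}) (H S ts : seq time)
    (s : option time * seq time) cont :
  map val ts = iota t (t' - t) -> (t <= t')%N ->
  (size H + size S + rank M + 2 <= m)%N ->
  time_feasible s.2 ->
  {subset H ++ S ++ seq_of_opt s.1 ++ s.2 <= B} ->
  (forall B' : {set time},
     {subset H ++ S ++ seq_of_opt (tscan S s ts).1 ++ (tscan S s ts).2 <= B'} ->
     valid_run M f o m t' B' (cont (tscan S s ts))) ->
  valid_run M f o m t B (arrivals H S ts s cont).
Proof.
move=> + + szm.
elim: ts t s B => [|x ts IH] t s B.
  move=> /(congr1 size) /esym/eqP; rewrite size_iota subn_eq0 => t't tt' fs sB.
  have -> : t = t' by apply/eqP; rewrite eqn_leq tt' t't.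
  exact.
case: (ltngtP t t') => [tt'|//|->]; last by rewrite subnn.
rewrite -(subnSK tt') => -[xt tsE] _ fs sB val.
rewrite -xt valid_Next; apply/and3P; split.
- by apply/subsetP => y; rewrite inE => /sB.
- have h1 := time_feasible_size fs.
  have h2 : (size (seq_of_opt s.1) <= 1)%N by case: (s.1).
  set L := H ++ _; apply: leq_trans szm.
  have h3 : (#|[set y in L]| <= size L)%N by rewrite cardsE card_size.
  rewrite cardsU1; apply: leq_trans (leq_add (leq_b1 _) h3) _.
  rewrite /L !size_cat; lia.
set B' := x |: _.
have B'B y : y \in H ++ S ++ seq_of_opt s.1 ++ s.2 -> y \in B'.
  by move=> yl; rewrite !inE yl orbT.
apply: valid_try_all.
- by move=> y ys; apply: B'B; rewrite !mem_cat ys !orbT.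
- move=> c /mapP[T TS ->] y /= /(swaps_subset TS); rewrite in_cons.
  case/predU1P => [->|yS]; first by rewrite !inE eqxx.
  by apply: B'B; rewrite !mem_cat yS !orbT.
rewrite scan_cons in val; set s1 := foldl _ _ _ in val *.
have s1E : s1 = s \/ exists c, [/\ c \in proposals S x, s1 = (Some c.1, c.2),
    time_feasible c.2 & time_value s.2 < time_value c.2].
  exact: foldl_keep_better.
move: s1 s1E val => s1 s1E val.
apply: IH; rewrite ?xt //; first by case: s1E => [->|[c [_ -> ? _]]].
move=> y; case: s1E => [->|]; first exact: B'B.
case=> c [/mapP[T TS ->] -> _ _] /=; rewrite !mem_cat inE.
case/or4P => [yH|yS|/eqP->|/(swaps_subset TS)].
- by apply: B'B; rewrite mem_cat yH.
- by apply: B'B; rewrite !mem_cat yS orbT.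
- by rewrite !inE eqxx.
rewrite in_cons => /predU1P[->|yS]; first by rewrite !inE eqxx.
by apply: B'B; rewrite !mem_cat yS orbT.
Qed.

(** [size H + size ws] never grows, because each window adds at most one item to [H]. *)
Lemma valid_run_run m t (B : {set time}) ws H S :
  map val (flatten (unzip2 ws)) = iota t (n - t) -> (t <= n)%N ->
  (size H + size ws + (rank M + rank M) + 2 <= m)%N ->
  time_feasible S -> {subset H ++ S <= B} ->
  valid_run M f o m t B (run ws H S).
Proof.
elim: ws t B H S => [|w ws IH] t B H S.
  move=> /(congr1 size) /esym/eqP; rewrite size_iota subn_eq0 => nt tn _ fS sB.
  rewrite /= eqn_leq nt tn; case/andP: fS => _ ->; rewrite /= andbT.
  by apply/subsetP => x; rewrite inE => xS; apply: sB; rewrite mem_cat xS orbT.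
rewrite /= map_cat => tsE tn szm fS sB.
have SB : {subset S <= B} by move=> x xS; apply: sB; rewrite mem_cat xS orbT.
apply: valid_try_all => //.
  move=> c /flatten_mapP[e /recall_mem eH /mapP[T TS ->]] x /= /(swaps_subset TS).
  by rewrite in_cons => /predU1P[->|/SB //]; apply: sB; rewrite mem_cat eH.
set s := foldl _ _ _.
have [tsz wsE wE] : [/\ (t + size w.2 <= n)%N,
    map val (flatten (unzip2 ws)) = iota (t + size w.2) (n - (t + size w.2))
  & map val w.2 = iota t (size w.2)].
  have sz : (size w.2 <= n - t)%N.
    by move/(congr1 size): tsE; rewrite size_cat size_iota size_map => <-; rewrite leq_addr.
  move: tsE; rewrite -{1}(subnKC sz) iotaD => /eqP; rewrite eqseq_cat ?size_iota ?size_map //.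
  case/andP => /eqP -> /eqP ->; rewrite subnDA; split => //.
  by move: sz tn; lia.
have fs : time_feasible s.2 by exact: scan_ok.
have szS := time_feasible_size fS.
apply: (@valid_arrivals _ _ (t + size w.2)%N) => //.
- by rewrite addKn.
- exact: leq_addr.
- by move: szm szS => /=; lia.
- move=> x; rewrite catA mem_cat => /orP[/sB //|]; move: x.
  have : s = (None, S) \/ exists c, [/\
      c \in flatten (map (proposals S) (recall H w.1)), s = (Some c.1, c.2),
      time_feasible c.2 & time_value S < time_value c.2].
    exact: foldl_keep_better.
  case=> [-> x /= /SB //|].
  case=> c [/flatten_mapP[e /recall_mem eH /mapP[T TS ->]] -> _ _] x /=.
  have eB : e \in B by apply: sB; rewrite mem_cat eH.
  rewrite in_cons => /predU1P[-> //|/(swaps_subset TS)].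
  by rewrite in_cons => /predU1P[-> //|/SB].
move=> B' sB'; set s' := scan _ _ _ _ _ in sB' *.
apply: IH => //.
- by have := remember_size H s'.1; move: szm => /=; lia.
- exact: scan_ok.
move=> x; rewrite mem_cat => /orP[xH|xS]; apply: sB'; last first.
  by rewrite !mem_cat xS !orbT.
move: xH; rewrite !mem_cat; case: (s'.1) => [e|] /=; last by move=> ->.
case: ifP => _; first by move=> ->.
by rewrite mem_rcons !in_cons => /orP[->|->]; rewrite ?orbT.
Qed.

End Semantics.
End Program.

(** * Approximation rate *)

Section Rate.
Variables (R : realType) (U : finType) (M : matroid U) (f : {set U} -> R).
Hypotheses (f_ge0 : forall A, 0 <= f A) (f_mono : monotone_setfun f).
Hypothesis f_sub : submodular f.
Variables (w m k : nat) (ord : seq U).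
Hypothesis mem_ord : forall x, x \in ord.
Hypotheses (m_ge2 : (1 < m)%N) (k_gt0 : (0 < k)%N) (wE : w.+1 = (m * m * k)%N).

Notation total := (total_value M f w ord).
Notation size_Omega := #|{ffun U + 'I_w.+1 -> 'I_w.+1}|.

(* The last m * k windows are ignored: there, an item not yet selected may be
   too likely to arrive in the current window. *)
Lemma total_deficit (O : {set U}) j : indep M O -> (#|O| <= k)%N ->
  (j <= m * m * k - m * k)%N ->
  size_Omega%:R * f O - 2 * total j <=
  (1 - 2 * (1 - m%:R^-1) / w.+1%:R) ^+ j * (size_Omega%:R * f O).
Proof.
move=> iO Ok; set N := size_Omega%:R * f O; set q := 1 - _.
have N0 : 0 <= N by rewrite mulr_ge0.
have m0 : 0 < m%:R :> R by rewrite ltr0n ltnW.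
have W0 : 0 < w.+1%:R :> R by rewrite ltr0n.
have q0 : 0 <= q.
  rewrite subr_ge0 ler_pdivrMr // mul1r.
  have : 2 <= w.+1%:R :> R by rewrite ler_nat wE; nia.
  have : 0 <= m%:R^-1 :> R by rewrite invr_ge0 ltW.
  by lra.
elim: j => [|j IH] jJ.
  have : 0 <= total 0 by apply: sumr_ge0 => om _; apply: f_ge0.
  by rewrite expr0 mul1r; lra.
have {}IH := IH (ltnW jJ).
have jw : (j < w.+1)%N by rewrite wE; lia.
have le_j : total j <= total j.+1 by apply: total_value_le.
have [B0|B0] := ltP (N - 2 * total j) 0.
  have : 0 <= q ^+ j.+1 * N by rewrite mulr_ge0 ?exprn_ge0.
  by lra.
have nk : (m * k <= w.+1 - j)%N by rewrite wE; lia.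
have kn : (#|O| <= w.+1 - j)%N by nia.
have := @total_value_step _ _ M f f_ge0 f_mono f_sub w ord mem_ord O (Ordinal jw) iO kn.
rewrite /= -/N; set n := (w.+1 - j)%N in nk kn *.
have n0 : 0 < n%:R :> R by rewrite ltr0n; nia.
move=> step.
(* As [m * k <= n] and [#|O| <= k], collisions lose at most a fraction [1/m]. *)
have le_n : n%:R * (1 - m%:R^-1) <= (n - #|O|)%:R :> R.
  rewrite (natrB _ kn) mulrBr mulr1 lerD2l lerN2 ler_pdivlMr //.
  by rewrite -natrM ler_nat (leq_trans _ nk) // mulnC leq_mul2l Ok orbT.
have {step le_n}step : (1 - m%:R^-1) * (N - 2 * total j) <=
    w.+1%:R * (total j.+1 - total j).
  rewrite -(ler_pM2l n0) mulrA; apply: le_trans step.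
  by rewrite ler_wpM2r.
have {}step : (1 - m%:R^-1) / w.+1%:R * (N - 2 * total j) <=
    total j.+1 - total j.
  by rewrite mulrAC ler_pdivrMr // [leRHS]mulrC.
apply: (@le_trans _ _ (q * (N - 2 * total j))).
  rewrite /q; move: step; set a := _ / _; rewrite -mulrA -/a; nra.
by rewrite exprS -mulrA ler_wpM2l.
Qed.

Lemma total_rate (O : {set U}) : indep M O -> (#|O| <= k)%N ->
  2^-1 * (1 - expR (- (2 * (1 - m%:R^-1) ^+ 2))) * (size_Omega%:R * f O) <=
  total w.+1.
Proof.
move=> iO Ok; set J := (m * m * k - m * k)%N.
have N0 : 0 <= size_Omega%:R * f O by rewrite mulr_ge0.
have JW : (J <= w.+1)%N by rewrite wE leq_subr.
apply: (@le_trans _ _ (total J)); last by apply: total_value_le.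
have := total_deficit iO Ok (leqnn J).
set q := 1 - _; set N := _ * f O in N0 * => leJ.
have m0 : m%:R != 0 :> R by rewrite pnatr_eq0; lia.
have k0 : k%:R != 0 :> R by rewrite pnatr_eq0; lia.
have q0 : 0 <= q.
  rewrite subr_ge0 ler_pdivrMr ?ltr0n // mul1r.
  have : 2 <= w.+1%:R :> R by rewrite ler_nat wE; nia.
  have : 0 <= m%:R^-1 :> R by rewrite invr_ge0 ler0n.
  by lra.
have : q ^+ J <= expR (- (2 * (1 - m%:R^-1) ^+ 2)).
  (* [J] is a fraction [1 - 1/m] of the [w.+1] windows, which supplies the second factor of the
     square. *)
  have -> : - (2 * (1 - m%:R^-1) ^+ 2) =
      J%:R * (- (2 * (1 - m%:R^-1) / w.+1%:R)) :> R.
    rewrite wE natrB; last by rewrite leq_mul2r leq_pmulr ?orbT //; lia.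
    by rewrite !natrM; field; rewrite k0 m0.
  rewrite expRM_natl lerXn2r ?nnegrE ?expR_ge0 //.
  exact: expR_ge1Dx.
move=> /(ler_wpM2r N0) le2; move: (le_trans leJ le2).
set E := expR _; lra.
Qed.

End Rate.

(** * Reduction to independent labels *)

Lemma perm_flatten_filter (T J : eqType) (l : T -> J) (s : seq T) (js : seq J) :
  uniq js ->
  perm_eq (flatten [seq [seq t <- s | l t == j] | j <- js])
          [seq t <- s | l t \in js].
Proof.
elim: js => [|j js IH] /= => [_|/andP[jjs /IH {}IH]].
  by rewrite (eq_filter (a2 := pred0)) ?filter_pred0.
apply: (@perm_trans _ ([seq t <- s | l t == j] ++ [seq t <- s | l t \in js])).
  by rewrite perm_cat2l.
set s' := [seq t <- s | l t \in j :: js].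
have -> : [seq t <- s | l t == j] = [seq t <- s' | l t == j].
  rewrite -filter_predI; apply: eq_filter => t /=.
  by rewrite in_cons; case: eqP.
have -> : [seq t <- s | l t \in js] = [seq t <- s' | predC (fun t => l t == j) t].
  rewrite -filter_predI; apply: eq_filter => t /=.
  by rewrite in_cons; case: eqP => //= ->; rewrite (negPf jjs).
by rewrite perm_filterC.
Qed.

Section Schedule.
Variables (n w : nat).
Notation time := 'I_n.
Implicit Types tau : {ffun time + 'I_w.+1 -> 'I_w.+1}.

Definition blocks tau : seq (seq time) :=
  mkseq (fun j => [seq t <- enum time | tau (inl t) == j :> nat]) w.+1.

(* Only the sizes of the blocks of equal labels matter: the windows are
   consecutive intervals of arrival times of these sizes. *)
Definition schedule tau : seq (nat * seq time) :=
  mkseq (fun j => (val (tau (inr (inord j))),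
    nth [::] (reshape (shape (blocks tau)) (enum time)) j)) w.+1.

Lemma perm_blocks tau : perm_eq (flatten (blocks tau)) (enum time).
Proof.
apply: perm_trans (perm_flatten_filter (fun t => val (tau (inl t))) (enum time)
  (iota_uniq 0 w.+1)) _.
rewrite (eq_filter (a2 := predT)) ?filter_predT // => t.
by rewrite mem_iota leq0n add0n ltn_ord.
Qed.

Lemma size_blocks tau : size (flatten (blocks tau)) = n.
Proof. by rewrite (perm_size (perm_blocks tau)) size_enum_ord. Qed.

(* The item arriving at time t of the sorted stream is the [unsort tau t]-th one
   of the unsorted stream. *)
Definition unsort tau (t : time) : time := nth t (flatten (blocks tau)) t.

Lemma unsort_inj tau : injective (unsort tau).
Proof.
move=> t t'; rewrite /unsort (set_nth_default t) ?size_blocks // => /eqP.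
rewrite nth_uniq ?size_blocks ?(perm_uniq (perm_blocks tau)) ?enum_uniq //.
by move/eqP/val_inj.
Qed.

Lemma map_unsort tau : map (unsort tau) (enum time) = flatten (blocks tau).
Proof.
have [n0|n_gt0] := posnP n.
  by rewrite (size0nil (etrans (size_blocks tau) n0)) [enum time]size0nil ?size_enum_ord.
pose t0 := Ordinal n_gt0.
apply: (@eq_from_nth _ t0) => [|i]; rewrite size_map size_enum_ord ?size_blocks //.
move=> lin; rewrite (nth_map t0) ?size_enum_ord // /unsort nth_enum_ord //.
by apply: set_nth_default; rewrite size_blocks.
Qed.

Lemma flatten_schedule tau : flatten (unzip2 (schedule tau)) = enum time.
Proof.
rewrite /unzip2 /schedule /mkseq -map_comp.
rewrite (_ : map _ _ = reshape (shape (blocks tau)) (enum time)).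
  by rewrite reshapeKr // size_enum_ord -size_flatten size_blocks.
have sz : size (reshape (shape (blocks tau)) (enum time)) = w.+1.
  by rewrite size_reshape size_map size_mkseq.
rewrite -[RHS](mkseq_nth [::]) sz; exact: eq_map.
Qed.

(** Sorting turns label classes into intervals; read back through [unsort tau], the intervals are
    the classes again, in their original relative order, as in [window_data]. *)
Lemma map_schedule tau :
  [seq (x.1, map (unsort tau) x.2) | x <- schedule tau] =
  mkseq (fun j => (val (tau (inr (inord j))),
     [seq t <- enum time | tau (inl t) == j :> nat])) w.+1.
Proof.
rewrite /schedule /mkseq -map_comp; apply/eq_in_map => j.
rewrite mem_iota leq0n add0n => jw.
rewrite [RHS](_ : _ = (val (tau (inr (inord j))), nth [::] (blocks tau) j)); last first.
  by rewrite nth_mkseq.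
congr (_, _).
have sz : size (reshape (shape (blocks tau)) (enum time)) = w.+1.
  by rewrite size_reshape size_map size_mkseq.
rewrite -(nth_map [::] [::] (map (unsort tau))) ?sz // map_reshape map_unsort.
by rewrite flattenK.
Qed.

End Schedule.

Definition window_alg (R : realType) (n w : nat) : streaming_alg R n :=
  draw [ffun=> ord0] (fun tau : {ffun 'I_n + 'I_w.+1 -> 'I_w.+1} =>
    run R (schedule tau) [::] [::]).

Section WindowAlg.
Variables (R : realType) (n w : nat) (U : finType).
Variables (M : matroid U) (f : {set U} -> R).
Notation Tau := {ffun 'I_n + 'I_w.+1 -> 'I_w.+1}.

Lemma time_feasible_nil (o : {ffun 'I_n -> U}) : time_feasible M o [::].
Proof.
rewrite /time_feasible /= (_ : [set x in _] = set0) ?imset0 ?indep_set0 //.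
Qed.

Lemma window_alg_valid (o : {ffun 'I_n -> U}) m : injective o ->
  (w.+1 + (rank M + rank M) + 2 <= m)%N ->
  valid_run M f o m 0 set0 (window_alg R n w).
Proof.
move=> oi wm; apply: valid_draw => tau; apply: valid_run_run => //.
- by rewrite flatten_schedule subn0 val_enum_ord.
- by rewrite size_mkseq.
- exact: time_feasible_nil.
Qed.

Lemma window_alg_evals (o : {ffun 'I_n -> U}) : injective o ->
  (num_evals M f o (window_alg R n w) <= 2 * (n + w.+1) * (rank M).+1)%N.
Proof.
move=> oi; apply: evals_draw => tau.
apply: leq_trans (evals_run _ oi _ _ (time_feasible_nil o)) _.
by rewrite flatten_schedule size_enum_ord size_mkseq.
Qed.

Lemma time_valueE (o : {ffun 'I_n -> U}) (s : seq 'I_n) :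
  time_value f o s = value_of f (map o s).
Proof.
congr f; apply/setP => x; rewrite inE.
apply/imsetP/mapP => -[t ts ->]; exists t => //; first by rewrite inE in ts.
by rewrite inE.
Qed.

Lemma time_feasibleE (o : {ffun 'I_n -> U}) (s : seq 'I_n) : injective o ->
  time_feasible M o s = feasible M (map o s).
Proof.
move=> oi; rewrite /time_feasible /feasible map_inj_uniq //; congr (_ && indep M _).
apply/setP => x; rewrite inE.
apply/imsetP/mapP => -[t ts ->]; exists t => //; first by rewrite inE in ts.
by rewrite inE.
Qed.

(** For fixed [o], carrying labels along the bijection [o] identifies the runs on the sorted streams
    with the label process on [U]. *)
Lemma sum_runs (o : {ffun 'I_n -> U}) : injective o -> #|U| = n ->
  \sum_(tau : Tau) time_value f [ffun t => o (unsort tau t)]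
    (process (time_value f [ffun t => o (unsort tau t)])
       (time_feasible M [ffun t => o (unsort tau t)]) (schedule tau)).2 =
  total_value M f w (map o (enum 'I_n)) w.+1.
Proof.
move=> oi cU.
have [o' oK o'K] : bijective o by apply: inj_card_bij; rewrite // card_ord cU.
rewrite /total_value.
rewrite (reindex (fun om : {ffun U + 'I_w.+1 -> 'I_w.+1} =>
  [ffun c => om (match c with inl t => inl (o t) | inr j => inr j end)] : Tau)); last first.
  exists (fun tau : Tau =>
    [ffun c => tau (match c with inl x => inl (o' x) | inr j => inr j end)]).
    by move=> om _; apply/ffunP => -[x|j]; rewrite !ffunE ?o'K.
  by move=> tau _; apply/ffunP => -[x|j]; rewrite !ffunE ?oK.
apply: eq_bigr => om _; set tau := [ffun c => _] : Tau.
set oo := [ffun t => _].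
have ooi : injective oo.
  by move=> t t'; rewrite !ffunE => /oi; apply: unsort_inj.
have -> : time_value f oo = value_of f \o map oo by apply/funext => s; rewrite time_valueE.
have -> : time_feasible M oo = feasible M \o map oo.
  by apply/funext => s; rewrite time_feasibleE.
have pE : map oo (process (value_of f \o map oo) (feasible M \o map oo)
    (schedule tau)).2 = (process (value_of f) (feasible M)
    [seq (x.1, map oo x.2) | x <- schedule tau]).2 by rewrite process_map.
transitivity (value_of f (process (value_of f) (feasible M)
    [seq (x.1, map oo x.2) | x <- schedule tau]).2); first by rewrite -pE.
congr (value_of f (process _ _ _).2).
have -> : [seq (x.1, map oo x.2) | x <- schedule tau] =
   [seq (x.1, map o x.2) | x <- [seq (x.1, map (unsort tau) x.2) | x <- schedule tau]].
  rewrite -[RHS]map_comp; apply: eq_map => x /=; rewrite -map_comp; congr (_, _).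
  by apply: eq_map => t; rewrite ffunE.
rewrite map_schedule /mkseq -map_comp; apply: eq_map => j /=.
rewrite /window_data ffunE; congr (_, _).
rewrite filter_map; congr map; apply: eq_filter => t /=.
by rewrite ffunE.
Qed.

(** For fixed labels, precomposition with the permutation [unsort tau] permutes the arrival orders,
    so a uniformly random order may be replaced by its sorted version. *)
Lemma window_alg_value : #|U| = n ->
  random_order_value M f (window_alg R n w) =
  (\sum_(o : {ffun 'I_n -> U} | injectiveb o)
     total_value M f w (map o (enum 'I_n)) w.+1) / #|Tau|%:R / n`!%:R.
Proof.
move=> cU; rewrite /random_order_value; congr (_ / _).
under eq_bigr do rewrite mean_draw.
rewrite -mulr_suml; congr (_ / _).
rewrite exchange_big.
under [RHS]eq_bigr => o /injectiveP oi do rewrite -sum_runs //.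
rewrite [RHS]exchange_big; apply: eq_bigr => tau _.
have [g unsortK gK] : bijective (unsort tau) by exact: injF_bij (@unsort_inj _ _ tau).
rewrite (reindex (fun o : {ffun 'I_n -> U} => [ffun t => o (unsort tau t)])).
  apply: eq_big => [o|o _]; last by rewrite mean_run.
  apply/injectiveP/injectiveP => oi t t'.
    by move=> e; rewrite -[t]gK -[t']gK; congr unsort; apply: oi; rewrite !ffunE !gK.
  by rewrite !ffunE => /oi; apply: unsort_inj.
exists (fun o : {ffun 'I_n -> U} => [ffun t => o (g t)]) => o _.
  by apply/ffunP => t; rewrite !ffunE gK.
by apply/ffunP => t; rewrite !ffunE unsortK.
Qed.

End WindowAlg.

(** * The guarantee *)

Section Guarantee.
Variables (R : realType) (n w m k : nat) (U : finType).
Variables (M : matroid U) (f : {set U} -> R).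
Hypotheses (f_ge0 : forall A, 0 <= f A) (f_mono : monotone_setfun f).
Hypothesis f_sub : submodular f.
Hypotheses (cardU : #|U| = n) (rankM : rank M = k).
Hypotheses (m_ge2 : (1 < m)%N) (k_gt0 : (0 < k)%N) (wE : w.+1 = (m * m * k)%N).

Lemma OPT_attained : exists2 O : {set U}, indep M O & OPT M f = f O.
Proof.
rewrite /OPT (bigmax_eq_arg _ set0) ?indep_set0 //.
by case: arg_maxP => [|O iO _]; [exact: indep_set0 | exists O].
Qed.

Lemma window_alg_approx :
  2^-1 * (1 - expR (- (2 * (1 - m%:R^-1) ^+ 2))) * OPT M f <=
  random_order_value M f (window_alg R n w).
Proof.
have [O iO ->] := OPT_attained.
have cO : (#|O| <= k)%N by rewrite -rankM; apply: indep_card.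
rewrite window_alg_value // ler_pdivlMr ?ltr0n ?fact_gt0 //.
have cT : #|{ffun 'I_n + 'I_w.+1 -> 'I_w.+1}| = #|{ffun U + 'I_w.+1 -> 'I_w.+1}|.
  by rewrite !card_ffun !card_sum !card_ord cardU.
have T0 : (0 < #|{ffun 'I_n + 'I_w.+1 -> 'I_w.+1}|)%N.
  by rewrite card_ffun card_ord expn_gt0.
rewrite ler_pdivlMr ?ltr0n // mulrAC.
have -> : n`! = #|[set o : {ffun 'I_n -> U} | injectiveb o]|.
  by rewrite card_inj_ffuns card_ord cardU ffactnn.
rewrite cardsE [leLHS]mulr_natr -sumr_const; apply: ler_sum => o /injectiveP oi.
rewrite -[leLHS]mulrA [f O * _]mulrC cT.
apply: (total_rate f_ge0 f_mono f_sub _ m_ge2 k_gt0 wE) => // x.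
have [o' _ o'K] : bijective o by apply: inj_card_bij; rewrite // card_ord cardU.
by rewrite -[x]o'K map_f // mem_enum.
Qed.

End Guarantee.

(** With [x = 1/m], [(1 - x)^2 >= 1 - 2 x] bounds the exponent by [-2 + 4 x]; then
    [expR (4 x) <= 1 + 8 x] and [8 x <= eps]. *)
Lemma expR_rate (R : realType) (eps : R) (m : nat) :
  (8 <= m)%N -> 8 <= eps * m%:R ->
  expR (- (2 * (1 - m%:R^-1) ^+ 2)) <= (expR 1 ^+ 2)^-1 + eps.
Proof.
move=> m8 epsm; have m0 : 0 < m%:R :> R by rewrite ltr0n; lia.
set x : R := m%:R^-1; have x0 : 0 < x by rewrite invr_gt0.
have x8 : 8 * x <= 1.
  by rewrite ler_pdivrMr // mul1r ler_nat.
have x8e : 8 * x <= eps by rewrite ler_pdivrMr.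
apply: (@le_trans _ _ (expR (- 2 + 4 * x))).
  by rewrite ler_expR; have := sqr_ge0 x; lra.
have e2 : (expR 1 ^+ 2)^-1 = expR (- 2) :> R.
  by rewrite -expRM_natl mulr1 expRN.
have e2_le1 : expR (- 2) <= 1 :> R by rewrite -[leRHS]expR0 ler_expR; lra.
(* From [expR (- 4 x) >= 1 - 4 x], and [(1 - 4 x) (1 + 8 x) >= 1] as [8 x <= 1]. *)
have e4 : expR (4 * x) <= 1 + 8 * x.
  have h := expR_ge1Dx (- (4 * x)); rewrite expRN in h.
  have h0 := expR_gt0 (4 * x).
  have : expR (4 * x) * (1 - 4 * x) <= 1.
    by rewrite mulrC -ler_pdivlMr // mul1r; lra.
  nra.
rewrite e2 expRD; have := expR_gt0 (- 2 : R); nra.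
Qed.

Theorem theorem4 (R : realType) (eps : R) (heps0 : 0 < eps) (heps1 : eps < 1) :
  exists (C1 C2 C3 : R) (eta : nat -> nat)
         (alg : forall n k : nat, streaming_alg R n),
    (forall k : nat, (0 < k)%N -> (eta k)%:R <= C2 * k%:R) /\
    forall (n k : nat) (U : finType) (M : matroid U) (f : {set U} -> R),
      #|U| = n -> rank M = k -> (0 < k)%N ->
      (forall A : {set U}, 0 <= f A) -> monotone_setfun f -> submodular f ->
      [/\ forall o : {ffun 'I_n -> U}, injective o ->
            valid_run M f o (eta k) 0 set0 (alg n k),
          2^-1 * (1 - (expR 1 ^+ 2)^-1 - eps - C1 / k%:R) * OPT M f
            <= random_order_value M f (alg n k)
        & forall o : {ffun 'I_n -> U}, injective o ->
            (num_evals M f o (alg n k))%:R / n%:R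
              <= C3 * (k%:R + k%:R ^+ 2 / n%:R)].
Proof.
have [m m8 epsm] : exists2 m : nat, (8 <= m)%N & 8 <= eps * m%:R.
  exists (Num.bound (8 / eps) + 8)%N; first by rewrite leq_addl.
  have := archi_boundP (divr_ge0 (ler0n R 8) (ltW heps0)).
  rewrite ltr_pdivrMr // natrD mulrDr [_ * eps]mulrC => /ltW/le_trans; apply.
  by rewrite lerDl mulr_ge0 // ltW.
(* The whole loss fits in [eps], so [C1 = 0]. For [k >= 1], [m^2 k + 2 k + 2 <= (m^2 + 4) k] gives
   [C2], and [2 (n + m^2 k) (k + 1) <= 4 m^2 (k n + k^2)] gives [C3]. *)
exists 0, (m * m + 4)%:R, (4 * (m * m))%:R, (fun k => m * m * k + (k + k) + 2)%N.
exists (fun n k => window_alg R n (m * m * k).-1); split.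
  by move=> k k0; rewrite -natrM ler_nat; nia.
move=> n k U M f cU rM k0 f0 fm fs.
have wE : (m * m * k).-1.+1 = (m * m * k)%N by rewrite prednK // !muln_gt0 k0; lia.
have n0 : (0 < n)%N.
  rewrite -cU lt0n; apply: contraL k0 => /eqP U0; rewrite -leqNgt -rM.
  by apply/bigmax_leqP => A _; rewrite -U0 max_card.
split=> [o oi||o oi].
- by apply: window_alg_valid; rewrite // wE rM.
- apply: le_trans (window_alg_approx f0 fm fs cU rM _ k0 wE); last by lia.
  rewrite mul0r subr0 ler_wpM2r //.
    by have [O _ ->] := OPT_attained M f0.
  have := expR_rate m8 epsm; lra.
have n0' : 0 < n%:R :> R by rewrite ltr0n.
rewrite ler_pdivrMr // -mulrA mulrDl divfK ?gt_eqF // -natrX -!natrM -natrD -natrM.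
rewrite ler_nat; apply: leq_trans (window_alg_evals _ _ _ oi) _.
have k2 : (k.+1 <= 2 * k)%N by lia.
have nk : (k * n <= m * m * (k * n))%N by rewrite leq_pmull // muln_gt0; lia.
rewrite wE rM expnS expn1; apply: leq_trans (leq_mul (leqnn _) k2) _.
by move: nk; nia.
Qed.
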